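(* Let $p\neq 2,5$ be a prime, let $K$ be the perfect closure of $\mathbb F_p(t)$, and let $C^-$ be the genus-$2$ curve $y^2=x^5-5x^3+5x+2-4t$ over $K$. Let $M$ be the Cartier–Manin matrix of $C^-$ with respect to the basis $\{dx/y,\ x\,dx/y\}$ of $H^0(C^-,\Omega^1)$. Then $$M=\begin{pmatrix}*&0\\0&*\end{pmatrix}\ \text{ if } p\equiv 1,4\pmod 5,\qquad M=\begin{pmatrix}0&*\\ *&0\end{pmatrix}\ \text{ if } p\equiv 2,3\pmod 5,$$ where the entries of $M^{(p)}$ lie in $\mathbb F_p[t]$.
   Context: The Cartier operator on $H^0(C,\Omega^1_C)$ is defined by $\mathscr C(d\varphi+\eta^p x^{p-1}dx)=\eta\,dx$ (every differential can be written in this form); it is $1/p$-linear. The Cartier–Manin matrix is its matrix with respect to a chosen basis (column $j$ = coordinates of the image of the $j$-th basis vector). $M^{(p)}$ denotes the matrix obtained by raising each entry of $M$ to the $p$-th power. *)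

(* Defs.v *)
From HB Require Import structures.
From mathcomp Require Import all_boot all_order all_algebra.
Set Implicit Arguments. Unset Strict Implicit. Unset Printing Implicit Defensive.
Import Order.TTheory GRing.Theory Num.Theory.
Local Open Scope ring_scope.

(* Evaluation at t of an integer polynomial, i.e. of an element of F_p[t]
   when the target has characteristic p. *)
Definition evZ (K : fieldType) (P : {poly int}) (t : K) : K :=
  (map_poly intr P).[t].

Definition is_perfect_closure_Fpt (p : nat) (K : fieldType) (t : K) : Prop :=
  [/\ p \in [pchar K],
      (forall a : K, exists b : K, b ^+ p = a),
      (forall P : {poly int}, evZ P t = 0 -> forall k, (p%:Z %| P`_k)%Z) &
      (forall a : K, exists n : nat, exists P Q : {poly int},
          evZ Q t != 0 /\ a ^+ (p ^ n) * evZ Q t = evZ P t)].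

Definition fCminus (K L : fieldType) (iota : {rmorphism K -> L}) (t : K) (x : L) : L :=
  x ^+ 5 - 5%:R * x ^+ 3 + 5%:R * x + 2%:R - 4%:R * iota t.

Definition is_function_field_Cminus (K L : fieldType) (iota : {rmorphism K -> L})
    (t : K) (x y : L) : Prop :=
  [/\ (forall q : {poly K}, q != 0 -> (map_poly iota q).[x] != 0),
      y ^+ 2 = fCminus iota t x &
      (forall h : L, exists a b c : {poly K},
          (map_poly iota c).[x] != 0 /\
          h = ((map_poly iota a).[x] + (map_poly iota b).[x] * y)
                / (map_poly iota c).[x])].

(* D is the K-derivation d/dx of L (so that every differential is h dx and
   d phi = (D phi) dx). *)
Definition is_ddx (K L : fieldType) (iota : {rmorphism K -> L}) (x : L) (D : L -> L) : Prop :=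
  [/\ (forall a b, D (a + b) = D a + D b),
      (forall a b, D (a * b) = a * D b + b * D a),
      (forall c, D (iota c) = 0) &
      D x = 1].

(* M is the Cartier--Manin matrix w.r.t. the basis {dx/y, x dx/y}:
   for the j-th basis vector x^j dx/y, writing
   x^j/y dx = d phi + eta^p x^(p-1) dx, its Cartier image eta dx equals
   sum_i M i j x^i dx/y  (column j = coordinates of the image). *)
Definition is_Cartier_Manin (p : nat) (K L : fieldType) (iota : {rmorphism K -> L})
    (x y : L) (D : L -> L) (M : 'M[K]_2) : Prop :=
  forall j : 'I_2, exists phi eta : L,
    x ^+ j / y = D phi + eta ^+ p * x ^+ p.-1 /\
    eta = \sum_(i < 2) iota (M i j) * x ^+ i / y.

(* Main.v *)
(** Multiplying [x^j/y = D phi + eta^p x^(p-1)] by the [D]-constant [y^p] and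
applying [D^(p-1)], where [D^p = 0], identifies [M i j ^ p] with the coefficient of
[x^((i+1)p-1)] in [x^j f^((p-1)/2)]. Under [x = z + 1/z] one has
[f = z^5 + z^-5 + s], so powers of [f] only involve exponents of [z] divisible
by 5. In characteristic [p], for [q = 1, 2] and [deg A < 3p - 1], the coefficient
of [x^(qp-1)] in [A] is also that of [z^(qp-1)] in [A(z + 1/z)(1 - z^-2)]: the
Cartier operator commutes with the substitution. Comparing exponents modulo 5
gives the vanishing entries. *)
Require Import Defs.
From HB Require Import structures.
From mathcomp Require Import all_boot all_order all_algebra.
From mathcomp Require Import ring zify.
Set Implicit Arguments.
Unset Strict Implicit.
Unset Printing Implicit Defensive.
Import GRing.Theory.
Local Open Scope ring_scope.

(** * Characteristic [p]: iterated derivatives and coefficients at exponents [q * p - 1] *)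

Section CharP.
Variables (p : nat) (K : fieldType).
Hypothesis pcharK : p \in [pchar K].

Lemma derivn_pchar (A : {poly K}) : A^`(p) = 0.
Proof.
rewrite nderivn_def -mulr_natr.
have /eqP -> : (p`!%:R == 0 :> {poly K}).
  rewrite -polyC_natr polyC_eq0 -(dvdn_pcharf pcharK).
  by apply: dvdn_fact; rewrite leqnn prime_gt0 ?(pcharf_prime pcharK).
by rewrite mulr0.
Qed.

(** The coefficient of [X^(i * p)] in the derivative is the wanted one times
    [(i * p + 1) ... (i * p + p.-1)], a product prime to [p]. *)
Lemma coef_derivn_pred_eq0 (A : {poly K}) (i : nat) :
  A^`(p.-1) = 0 -> A`_(i * p + p.-1) = 0.
Proof.
move=> A0; have p_pr := pcharf_prime pcharK.
have := coef_derivn p.-1 A (i * p).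
rewrite A0 coef0 [(p.-1 + _)%N]addnC -mulr_natr => /esym/eqP.
rewrite mulf_eq0 => /orP[/eqP //|].
rewrite -(dvdn_pcharf pcharK) => p_dvd; exfalso; move: p_dvd.
rewrite ffact_prod Euclid_dvd_prod // big_orE => /existsP[j]; apply/negP.
have pgt0 := prime_gt0 p_pr.
have jlt := ltn_ord j.
rewrite -addnBA; last lia.
rewrite dvdn_addr ?dvdn_mull //.
by rewrite gtnNdvd //; lia.
Qed.

(** This is the coefficient of [z^(q * p - 1)] in [(z + 1/z)^k * (1 - z^-2)], with denominators
    cleared by [z^(k + 2)]. *)
Lemma coef_ballot (k q : nat) : p != 2%N -> (0 < q < 3)%N -> (k.+1 < 3 * p)%N ->
  ((('X^2 - 1) * ('X^2 + 1) ^+ k : {poly K})`_(k + q * p).+1) = (k.+1 == q * p)%:R.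
Proof.
move=> p_neq2 q_bound k_bound; have p_pr := pcharf_prime pcharK.
set G := _ * _.
(* [(k+1) G] comes from the derivative of [(z + 1/z)^(k+1)], which has no
   [z^(qp-1)] term in characteristic [p]. *)
have key : (k.+1)%:R * G`_(k + q * p).+1 = 0.
  have : (k.+1)%:R *: G = 'X * (('X^2 + 1) ^+ k.+1)^`() - (k.+1)%:R *: ('X^2 + 1) ^+ k.+1.
    rewrite deriv_exp derivD derivXn derivC addr0 /= !scaler_nat mulrnAr -mulrnBl; congr (_ *+ _).
    by rewrite /G [(_ + 1) ^+ k.+1]exprS expr1; ring.
  move/(congr1 (fun P : {poly K} => P`_(k + q * p).+1)).
  rewrite coefZ => ->; rewrite coefB coefZ coefXM /= coef_deriv -[_ *+ _]mulr_natl -mulrBl.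
  rewrite -natrB; last lia.
  have -> : ((k + q * p).+1 - k.+1 = q * p)%N by lia.
  have /eqP -> : ((q * p)%:R == 0 :> K) by rewrite -(dvdn_pcharf pcharK) dvdn_mull.
  by rewrite mul0r.
have [/dvdnP[r k1E]|ndvd] := boolP (p %| k.+1)%N; last first.
  have -> : (k.+1 == q * p)%N = false.
    by apply: contraNF ndvd => /eqP ->; rewrite dvdn_mull.
  by move/eqP: key; rewrite mulf_eq0 -(dvdn_pcharf pcharK) (negPf ndvd) => /eqP.
(* [G] is a polynomial in [X^2], read at index [(r + q) * p]: for [r = q] this is its degree
   [2 * k.+1], otherwise it is the odd number [3 * p]. *)
have Gcomp : G = (('X - 1) * ('X + 1) ^+ k) \Po 'X^2.
  by rewrite rmorphM rmorphXn rmorphB rmorphD rmorph1 /= comp_polyX.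
have p_gt0 := prime_gt0 p_pr.
have mon1 : ('X - 1 : {poly K}) \is monic by rewrite -polyC1 monicXsubC.
have mon2 : ('X + 1 : {poly K}) \is monic by rewrite -[1]opprK -polyC1 -polyCN monicXsubC.
have monU : (('X - 1) * ('X + 1) ^+ k : {poly K}) \is monic by rewrite monicMl // monic_exp.
have sU : size (('X - 1) * ('X + 1) ^+ k : {poly K}) = k.+2.
  have -> : ('X + 1 : {poly K}) = 'X - (- 1)%:P by rewrite polyCN polyC1 opprK.
  by rewrite size_monicM ?monic_neq0 ?monic_exp ?monicXsubC // -polyC1 size_XsubC size_exp_XsubC.
have -> : ((k + q * p).+1 = (r + q) * p)%N by lia.
rewrite Gcomp coef_comp_poly_Xn // k1E eqn_pmul2r //.
have r_bound : (0 < r < 3)%N by apply/andP; split; nia.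
have [rq|] := eqVneq r q.
  rewrite -rq addnn -muln2 mulnAC dvdn_mull // mulnK // -k1E.
  by move/monicP: monU; rewrite /lead_coef sU.
move=> rq; case: ifP => // /dvdnP[m mE].
have p_odd : odd p by case: (even_prime p_pr) p_neq2 => // ->.
have rq3 : (r + q = 3)%N by move: rq; lia.
by move/(congr1 odd): mE; rewrite rq3 !oddM p_odd andbF.
Qed.

(* [homog N A] is [z^N A(z + 1/z)] as a polynomial in [z], for [size A <= N.+1]. *)
Definition homog (N : nat) (A : {poly K}) : {poly K} :=
  \sum_(k < N.+1) A`_k *: (('X^2 + 1) ^+ k * 'X^(N - k)).

(** Linear extension of [coef_ballot]; clearing denominators by [z^(N + 2)] shifts the index
    [q * p - 1] by [N + 2]. *)
Lemma coef_homog (N q : nat) (A : {poly K}) : p != 2%N -> (0 < q < 3)%N ->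
  (size A <= N.+1)%N -> (size A < 3 * p)%N ->
  (('X^2 - 1) * homog N A)`_(N + q * p).+1 = A`_(q * p).-1.
Proof.
move=> p_neq2 q_bound sAN sAp; have p_gt0 := prime_gt0 (pcharf_prime pcharK).
have qp_gt0 : (0 < q * p)%N by rewrite muln_gt0 p_gt0 andbT; case/andP: q_bound.
have coefE (k : 'I_N.+1) :
  (('X^2 - 1) * (A`_k *: (('X^2 + 1) ^+ k * 'X^(N - k))))`_(N + q * p).+1
   = A`_k *+ (k == (q * p).-1 :> nat).
  rewrite -scalerAr coefZ mulrA coefMXn.
  have kN : (k <= N)%N by have := ltn_ord k; lia.
  have -> : ((N + q * p).+1 < N - k)%N = false by lia.
  have -> : ((N + q * p).+1 - (N - k) = (k + q * p).+1)%N by lia.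
  have [kA|Ak] := leqP (size A) k; first by rewrite nth_default // mul0r mul0rn.
  rewrite coef_ballot //; last lia.
  have -> : (k.+1 == q * p)%N = (k == (q * p).-1 :> nat) by rewrite -[RHS]eqSS prednK.
  by rewrite mulr_natr.
rewrite mulr_sumr coef_sum (eq_bigr _ (fun k _ => coefE k)).
have [qN|Nq] := ltnP (q * p).-1 N.+1.
  rewrite (bigD1 (Ordinal qN)) //= eqxx big1 ?addr0 // => k kq.
  by rewrite -val_eqE /= in kq; rewrite (negPf kq).
(* Here [(q * p).-1] exceeds [N]: no summand survives, and the right-hand side is the default [0]
   past the size of [A]. *)
rewrite big1 => [|k _]; first by rewrite nth_default ?(leq_trans sAN).
by have /negPf -> : (k != (q * p).-1 :> nat); rewrite ?mulr0n //; have := ltn_ord k; lia.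
Qed.

End CharP.

(** * The substitution [x = z + 1/z] and the Dickson polynomial *)

Lemma mulr_addV (F : fieldType) (z : F) : z != 0 -> z * (z + z^-1) = z ^+ 2 + 1.
Proof. by move=> z0; rewrite mulrDr divff // -expr2. Qed.

(* [D_5(z + 1/z) = z^5 + z^-5] for the Dickson polynomial [D_5]. *)
Lemma dickson5_addV (F : fieldType) (z s : F) : z != 0 ->
  z ^+ 5 * ((z + z^-1) ^+ 5 - 5%:R * (z + z^-1) ^+ 3 + 5%:R * (z + z^-1) + s)
    = (z ^+ 5) ^+ 2 + s * z ^+ 5 + 1.
Proof. by move=> z0; field. Qed.

Section Homogenization.
Variable K : fieldType.
Local Notation frac := (@tofrac {poly K}).
Local Notation z := (frac 'X).
Local Notation fpoly A := (map_poly (frac \o polyC) A).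

(** In the fraction field [z] is invertible, and the embedding is injective, so identities about
    [homog] can be checked there. *)
Lemma tofrac_homog (N : nat) (A : {poly K}) : (size A <= N.+1)%N ->
  frac (homog N A) = z ^+ N * (fpoly A).[z + z^-1].
Proof.
move=> sA; have z0 : z != 0 by rewrite tofrac_eq0 polyX_eq0.
rewrite (horner_coef_wide _ (leq_trans (size_poly _ _) sA)) mulr_sumr /homog rmorph_sum.
apply: eq_bigr => k _; have kN : (k <= N)%N by have := ltn_ord k; lia.
rewrite coef_map /= -mul_polyC !rmorphM !rmorphXn rmorphD rmorphXn rmorph1 /= [RHS]mulrCA.
congr (_ * _).
have -> : z ^+ N = z ^+ k * z ^+ (N - k) by rewrite -exprD subnKC.
by rewrite [RHS]mulrAC -exprMn mulr_addV.
Qed.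

Lemma homogXM (N : nat) (A : {poly K}) : (size A <= N.+1)%N ->
  homog N.+1 ('X * A) = ('X^2 + 1) * homog N A.
Proof.
move=> sA; have z0 : z != 0 by rewrite tofrac_eq0 polyX_eq0.
have sXA : (size ('X * A)%R <= N.+2)%N.
  by apply: leq_trans (size_polyMleq _ _) _; rewrite size_polyX.
apply/eqP; rewrite -tofrac_eq; apply/eqP.
rewrite rmorphM /= !tofrac_homog // rmorphM /= map_polyX hornerM hornerX.
by rewrite rmorphD rmorphXn rmorph1 /= exprS mulrACA mulr_addV.
Qed.

(** The Dickson polynomial [D_5] plus a constant; the curve is the case [s = 2 - 4t]. *)
Definition dickson5 (s : K) : {poly K} :=
  'X^5 - 5%:R *: 'X^3 + 5%:R *: 'X + s%:P.

Lemma horner_map_dickson5 (F : fieldType) (g : {rmorphism K -> F}) (s : K) (u : F) :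
  (map_poly g (dickson5 s)).[u] = u ^+ 5 - 5%:R * u ^+ 3 + 5%:R * u + g s.
Proof.
rewrite /dickson5 !rmorphD rmorphN /= !map_polyZ map_polyX !map_polyXn map_polyC !hornerE.
by rewrite /= !rmorph_nat.
Qed.

Lemma size_dickson5 (s : K) : size (dickson5 s) = 6%N.
Proof.
rewrite /dickson5 -!addrA size_polyDl size_polyXn //.
rewrite ltnS (leq_trans (size_polyD _ _)) // geq_max size_polyN.
rewrite (leq_trans (size_scale_leq _ _)) ?size_polyXn //=.
rewrite (leq_trans (size_polyD _ _)) // geq_max.
rewrite (leq_trans (size_scale_leq _ _)) ?size_polyX //=.
by rewrite (leq_trans (size_polyC_leq1 _)).
Qed.

Lemma size_dickson5_exp (s : K) (n : nat) : size (dickson5 s ^+ n) = (5 * n).+1.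
Proof.
have F0 : dickson5 s ^+ n != 0 by rewrite expf_neq0 // -size_poly_eq0 size_dickson5.
by rewrite -[LHS]prednK ?size_poly_gt0 // size_exp size_dickson5.
Qed.

(** [z^5 * (z^5 + z^-5 + s)] is [X^2 + s X + 1] evaluated at [z^5]. *)
Lemma homog_dickson5_exp (s : K) (n : nat) :
  homog (5 * n) (dickson5 s ^+ n) = ('X^2 + s *: 'X + 1) ^+ n \Po 'X^5.
Proof.
have z0 : z != 0 by rewrite tofrac_eq0 polyX_eq0.
apply/eqP; rewrite -tofrac_eq; apply/eqP.
rewrite tofrac_homog ?size_dickson5_exp // exprM rmorphXn horner_exp -exprMn.
rewrite !rmorphXn /=; congr (_ ^+ n).
rewrite horner_map_dickson5 /= comp_polyD comp_polyD comp_polyZ comp_polyX -polyC1.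
rewrite comp_polyC comp_Xn_poly polyC1 -mul_polyC !rmorphD rmorph1 !rmorphXn /=.
rewrite [tofrac (_ * _)]rmorphM rmorphXn /=.
exact: dickson5_addV.
Qed.

End Homogenization.

(** * The derivation [D] and the Cartier-Manin entries as coefficients *)

Section CartierDerivation.
Variables (p : nat) (K L : fieldType) (iota : {rmorphism K -> L}) (x : L) (D : L -> L).
Hypothesis pcharK : p \in [pchar K].
Hypothesis D_ddx : is_ddx iota x D.

Let DD a b : D (a + b) = D a + D b. Proof. by case: D_ddx. Qed.
Let DM a b : D (a * b) = a * D b + b * D a. Proof. by case: D_ddx. Qed.
Let DK c : D (iota c) = 0. Proof. by case: D_ddx. Qed.
Let Dx : D x = 1. Proof. by case: D_ddx. Qed.

Lemma ddxX (u : L) (n : nat) : D (u ^+ n) = u ^+ n.-1 * D u *+ n.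
Proof.
elim: n => [|n IHn]; first by rewrite expr0 mulr0n -(rmorph1 iota) DK.
rewrite exprS DM IHn mulrnAr /=.
case: n {IHn} => [|n]; first by rewrite mulr0n add0r.
by rewrite mulrA -exprS addrC -mulrS.
Qed.

Lemma ddx_pth_power (u : L) : D (u ^+ p) = 0.
Proof.
by rewrite ddxX -mulr_natr -(rmorph_nat iota) (pcharf0 pcharK) rmorph0 mulr0.
Qed.

Lemma ddx_horner (A : {poly K}) : D (map_poly iota A).[x] = (map_poly iota A^`()).[x].
Proof.
elim/poly_ind: A => [|A c IHA].
  by rewrite deriv0 !rmorph0 horner0 -(rmorph0 iota) DK rmorph0.
rewrite derivMXaddC !rmorphD !rmorphM /= map_polyX map_polyC !hornerE /=.
by rewrite DD DK DM Dx IHA addr0 mulr1 [x * _]mulrC.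
Qed.

Lemma iter_ddxD (n : nat) (a b : L) : iter n D (a + b) = iter n D a + iter n D b.
Proof. by elim: n => //= n ->; rewrite DD. Qed.

Lemma iter_ddx_horner (n : nat) (u : L) (A : {poly K}) : D u = 0 ->
  iter n D (u * (map_poly iota A).[x]) = u * (map_poly iota A^`(n)).[x].
Proof.
move=> Du; elim: n => [|n IHn]; first by rewrite derivn0.
by rewrite iterS IHn DM Du mulr0 addr0 ddx_horner derivnS.
Qed.

(** Every element of [L] is a combination of polynomials in [x] with [p]-th powers, hence
    [D]-constants, as coefficients. *)
Lemma iter_ddx_eq0 (y : L) (f : {poly K}) : y != 0 -> odd p ->
  y ^+ 2 = (map_poly iota f).[x] ->
  (forall h : L, exists a b c : {poly K}, (map_poly iota c).[x] != 0 /\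
     h = ((map_poly iota a).[x] + (map_poly iota b).[x] * y) / (map_poly iota c).[x]) ->
  forall h, iter p D h = 0.
Proof.
move=> y0 p_odd yf gen h; have [a [b [c [c0 ->]]]] := gen h.
have p_gt0 : (0 < p)%N by exact: odd_gt0.
set cx := (map_poly iota c).[x] in c0 *.
(* [y = y^-p * f^((p+1)/2)], a [D]-constant times a polynomial in [x]. *)
have yE : y = y^-1 ^+ p * (map_poly iota (f ^+ p.+1./2)).[x].
  rewrite [map_poly _ _]rmorphXn /= horner_exp -yf -exprM mulnC.
  have -> : (p.+1./2 * 2 = p.+1)%N by rewrite muln2 halfK /= p_odd subn0.
  by rewrite exprVn exprSr mulrA mulVf ?mul1r // expf_neq0.
have cE : cx^-1 = cx^-1 ^+ p * (map_poly iota (c ^+ p.-1)).[x].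
  rewrite [map_poly _ _]rmorphXn /= horner_exp -/cx -[in X in _ ^+ X](prednK p_gt0) exprS.
  by rewrite -mulrA -exprMn mulVf // expr1n mulr1.
have -> : ((map_poly iota a).[x] + (map_poly iota b).[x] * y) / cx
  = cx^-1 ^+ p * (map_poly iota (a * c ^+ p.-1)).[x]
    + (cx^-1 * y^-1) ^+ p * (map_poly iota (b * f ^+ p.+1./2 * c ^+ p.-1)).[x].
  by rewrite {1}cE {1}yE exprMn !rmorphM !hornerM /=; ring.
rewrite iter_ddxD !iter_ddx_horner ?ddx_pth_power //.
by rewrite !(derivn_pchar pcharK) !rmorph0 !horner0 !mulr0 addr0.
Qed.

Lemma Cartier_Manin_coef (y : L) (f : {poly K}) (M : 'M[K]_2) : odd p ->
  (forall q : {poly K}, q != 0 -> (map_poly iota q).[x] != 0) ->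
  y ^+ 2 = (map_poly iota f).[x] -> f != 0 ->
  (forall h : L, exists a b c : {poly K}, (map_poly iota c).[x] != 0 /\
     h = ((map_poly iota a).[x] + (map_poly iota b).[x] * y) / (map_poly iota c).[x]) ->
  is_Cartier_Manin p iota x y D M ->
  forall i j : 'I_2, M i j ^+ p = ('X^j * f ^+ p./2)`_(i * p + p.-1).
Proof.
move=> p_odd trans yf f0 gen CM i j.
have p_pr := pcharf_prime pcharK; have p_gt0 := prime_gt0 p_pr.
have y0 : y != 0.
  by apply: contraNneq (trans _ f0) => y0; rewrite -yf y0 expr0n.
have [phi [eta [xjE etaE]]] := CM j.
(* Chosen so that [Q(x) = y^p * eta^p * x^(p-1)]: Frobenius is additive, so [eta^p] expands
   termwise. *)
pose Q := \sum_(k < 2) M k j ^+ p *: 'X^(k * p + p.-1).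
pose P := 'X^j * f ^+ p./2 - Q.
have pcharL : p \in [pchar L] by rewrite (fmorph_pchar iota).
have QE : (map_poly iota Q).[x] = y ^+ p * (eta ^+ p * x ^+ p.-1).
  rewrite etaE -!(pFrobenius_autE pcharL) rmorph_sum /= /Q rmorph_sum /= horner_sum.
  rewrite mulr_suml mulr_sumr; apply: eq_bigr => k _.
  rewrite !pFrobenius_autE map_polyZ /= map_polyXn hornerZ hornerXn rmorphXn.
  rewrite !exprMn exprVn -exprM exprD.
  by field; rewrite expf_neq0.
(* Multiplying by the constant [y^p] keeps the exact part exact; the factor [1] is the [D]-constant
   expected by [iter_ddx_horner]. *)
have PE : 1 * (map_poly iota P).[x] = D (y ^+ p * phi).
  rewrite mul1r (_ : D _ = y ^+ p * D phi); last by rewrite DM ddx_pth_power mulr0 addr0.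
  have -> : D phi = x ^+ j / y - eta ^+ p * x ^+ p.-1 by rewrite xjE addrK.
  rewrite rmorphB hornerD hornerN QE mulrBr; congr (_ - _).
  rewrite rmorphM !rmorphXn /= map_polyX !hornerE -yf -exprM.
  have -> : y ^+ p = y * y ^+ (2 * p./2).
    by rewrite -exprS; congr (_ ^+ _); rewrite mul2n -[LHS]odd_double_half p_odd.
  by rewrite /=; field.
(* Applying [D] to [P(x)] [p.-1] times gives [D^p (y^p * phi) = 0], and [x] is transcendental over
   [K]. *)
have P0 : P^`(p.-1) = 0.
  apply/eqP; apply: contraT => /trans; rewrite -[X in X != 0]mul1r.
  rewrite -iter_ddx_horner; last by rewrite -(rmorph1 iota) DK.
  by rewrite PE -iterSr prednK // (iter_ddx_eq0 y0 p_odd yf gen) eqxx.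
have /eqP := coef_derivn_pred_eq0 pcharK i P0.
rewrite coefB subr_eq0 => /eqP ->.
rewrite /Q coef_sum (bigD1 i) //= coefZ coefXn eqxx mulr1 big1 ?addr0 // => k ki.
rewrite coefZ coefXn eqn_add2r eqn_pmul2r // eq_sym.
by rewrite -val_eqE /= in ki; rewrite (negPf ki) mulr0.
Qed.

End CartierDerivation.

(** * Vanishing coefficients by comparing exponents modulo 5 *)

Section Vanishing.
Variables (p : nat) (K : fieldType) (s : K).
Hypotheses (pcharK : p \in [pchar K]) (p_odd : odd p).
Let F := dickson5 s ^+ p./2.

Let p_half : (p = (2 * p./2).+1)%N.
Proof. by rewrite mul2n -[LHS]odd_double_half p_odd. Qed.

Let p_neq2 : p != 2%N.
Proof. by apply: contraTneq p_odd => ->. Qed.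

(** With [N = 5 * p./2], [homog] is a polynomial in [X^5]; the factor [X^2 - 1] makes it contribute
    only at indices [N + q * p + 1] and [N + q * p - 1]. *)
Lemma coef_dickson5_exp_eq0 (q : nat) : (0 < q < 3)%N ->
  ~~ (5 %| q * p + 1)%N -> ~~ (5 %| q * p - 1)%N -> F`_(q * p).-1 = 0.
Proof.
move=> q_bound ndvd1 ndvd2; have p_gt0 := prime_gt0 (pcharf_prime pcharK).
have qp_gt0 : (0 < q * p)%N by rewrite muln_gt0 p_gt0 andbT; case/andP: q_bound.
have sF := size_dickson5_exp s p./2.
rewrite -(coef_homog pcharK (N := 5 * p./2)) // -/F ?sF //; last lia.
rewrite homog_dickson5_exp mulrBl mul1r coefB coefXnM !coef_comp_poly_Xn //.
rewrite ifN; last lia.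
by rewrite !ifN ?subr0 //; lia.
Qed.

(** The extra [X] contributes [X^2 + 1], turning the factor into [X^4 - 1]; with [N] one larger, the
    two indices are [q * p + 2] and [q * p - 2] modulo 5. *)
Lemma coefX_dickson5_exp_eq0 (q : nat) : (0 < q < 3)%N ->
  ~~ (5 %| q * p + 2)%N -> ~~ (5 %| q * p - 2)%N -> ('X * F)`_(q * p).-1 = 0.
Proof.
move=> q_bound ndvd1 ndvd2; have p_gt0 := prime_gt0 (pcharf_prime pcharK).
have qp_gt0 : (0 < q * p)%N by rewrite muln_gt0 p_gt0 andbT; case/andP: q_bound.
have sF := size_dickson5_exp s p./2.
have sXF : size ('X * F) = (5 * p./2).+2.
  by rewrite mulrC size_mulX ?sF // -size_poly_eq0 sF.
rewrite -(coef_homog pcharK (N := (5 * p./2).+1)) ?sXF //; last lia.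
rewrite homogXM ?sF // homog_dickson5_exp mulrA.
have -> : ('X^2 - 1) * ('X^2 + 1) = 'X^4 - 1 :> {poly K} by ring.
rewrite mulrBl mul1r coefB coefXnM !coef_comp_poly_Xn //.
rewrite ifN; last lia.
by rewrite !ifN ?subr0 //; lia.
Qed.

End Vanishing.

(** Taking coefficients commutes with specializing an indeterminate to [t], so [P] is the same
    coefficient computed over integer polynomials. *)
Lemma coef_dickson5_evZ (K : fieldType) (t : K) (n j k : nat) :
  exists P : {poly int}, ('X^j * dickson5 (2%:R - 4%:R * t) ^+ n)`_k = evZ P t.
Proof.
pose ev : {rmorphism {poly int} -> K} := horner_eval t \o map_poly intr.
pose G : {poly {poly int}} :=
  'X^5 - 5%:R *: 'X^3 + 5%:R *: 'X + (2%:R - 4%:R * 'X)%:P.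
have evG : map_poly ev G = dickson5 (2%:R - 4%:R * t).
  rewrite /G rmorphD rmorphD rmorphB /= !map_polyZ map_polyX !map_polyXn map_polyC /= !rmorph_nat.
  congr (_ + _%:P).
  by rewrite -[LHS]/(ev _) rmorphB rmorphM !rmorph_nat /= map_polyX /horner_eval hornerX.
exists ('X^j * G ^+ n)`_k.
by rewrite -[RHS]/(ev _) -coef_map rmorphM !rmorphXn /= map_polyX evG.
Qed.

Theorem theorem4p1 (p : nat) (K L : fieldType) (t : K)
    (iota : {rmorphism K -> L}) (x y : L) (D : L -> L) (M : 'M[K]_2) :
  prime p -> p != 2%N -> p != 5%N ->
  is_perfect_closure_Fpt p t ->
  is_function_field_Cminus iota t x y ->
  is_ddx iota x D ->
  is_Cartier_Manin p iota x y D M ->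
  [/\ ((p %% 5 == 1)%N || (p %% 5 == 4)%N -> M 0 1 = 0 /\ M 1 0 = 0),
      ((p %% 5 == 2)%N || (p %% 5 == 3)%N -> M 0 0 = 0 /\ M 1 1 = 0) &
      (forall i j : 'I_2, exists P : {poly int}, (M i j) ^+ p = evZ P t)].
Proof.
move=> p_pr p_neq2 _ [pcharK _ _ _] [trans yf gen] D_ddx CM.
have p_odd : odd p by case: (even_prime p_pr) p_neq2 => // ->.
have p_gt0 := prime_gt0 p_pr.
set s := 2%:R - 4%:R * t.
have sf0 : dickson5 s != 0 by rewrite -size_poly_eq0 size_dickson5.
have {}yf : y ^+ 2 = (map_poly iota (dickson5 s)).[x].
  by rewrite yf /fCminus horner_map_dickson5 [iota s]rmorphB rmorphM !rmorph_nat -addrA.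
have ME := Cartier_Manin_coef pcharK D_ddx p_odd trans yf sf0 gen CM.
(* Row [i] corresponds to [q = i.+1], and column [j] to the factor [X^j]. *)
have ME0 i : M i 0 ^+ p = (dickson5 s ^+ p./2)`_(i.+1 * p).-1.
  by rewrite ME mul1r; congr (_`_ _); lia.
have ME1 i : M i 1 ^+ p = ('X * dickson5 s ^+ p./2)`_(i.+1 * p).-1.
  by rewrite ME expr1; congr (_`_ _); lia.
have M0 i j : M i j ^+ p = 0 -> M i j = 0.
  by move/eqP; rewrite expf_eq0 p_gt0 => /eqP.
(* Excludes [p = 1], where the truncated [p - 2] would be [0], a multiple of 5. *)
have p_gt1 := prime_gt1 p_pr.
split=> [pmod|pmod|i j]; last by rewrite ME; exact: coef_dickson5_evZ.
- split; apply: M0.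
    by rewrite (ME1 0) (coefX_dickson5_exp_eq0 s pcharK p_odd (q := 1)) //; lia.
  by rewrite (ME0 1) (coef_dickson5_exp_eq0 s pcharK p_odd (q := 2)) //; lia.
- split; apply: M0.
    by rewrite (ME0 0) (coef_dickson5_exp_eq0 s pcharK p_odd (q := 1)) //; lia.
  by rewrite (ME1 1) (coefX_dickson5_exp_eq0 s pcharK p_odd (q := 2)) //; lia.
Qed.
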